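(* Let $n,t$ be integers with $n\neq t^3$ and $n\equiv t^3\pmod 3$, and set $N_1:=\frac{n-t^3}{3}$. Then the number of triples $(x,y,z)\in\mathbb{Z}^3$ with $$x^3+y^3+z^3=n,\qquad x+y+z=t,$$ is $$R(t,n)=-\sum_{\substack{0<d\mid N_1\\ (N_1/d+2t)^2=4d}}1+2\sum_{0\neq \mathrm{abs}(d)\mid N_1}S_{\mathbb{Z}_+}\!\left(\left(\frac{N_1}{d}+2t\right)^2-4d\right),$$ where the first sum is over positive divisors $d$ of $N_1$ and the second over all nonzero integer divisors $d$ of $N_1$, positive and negative.
   Context: For an integer $m$, $S_{\mathbb{Z}_+}(m)=1$ if $m$ is the square of a nonnegative integer (so $S_{\mathbb{Z}_+}(0)=1$), and $S_{\mathbb{Z}_+}(m)=0$ otherwise. Representations are ordered triples of integers. *)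

(* Defs.v *)
From mathcomp Require Import all_boot all_order all_algebra.
From mathcomp Require Import finmap.
From mathcomp Require Import boolp classical_sets functions cardinality fsbigop.
Set Implicit Arguments.
Unset Strict Implicit.
Unset Printing Implicit Defensive.
Import Order.TTheory GRing.Theory Num.Theory.
Local Open Scope classical_set_scope.
Local Open Scope ring_scope.

Definition square_ind (m : int) : int :=
  if `[< exists k : nat, m = k%:Z ^+ 2 >] then 1 else 0.

Definition cube_triples (t n : int) : set (int * int * int) :=
  [set p | let: (x, y, z) := p in
           x ^+ 3 + y ^+ 3 + z ^+ 3 = n /\ x + y + z = t].

(* [fset_set] of an infinite set is empty, so this is the number of triples
   only together with [finite_set (cube_triples t n)]. *)
Definition num_cube_triples (t n : int) : nat :=
  #|` fset_set (cube_triples t n)|.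

(* Main.v *)
Require Import Defs.
From mathcomp Require Import all_boot all_order all_algebra.
From mathcomp Require Import finmap.
From mathcomp Require Import boolp classical_sets functions cardinality fsbigop.
From mathcomp Require Import zify ring.
Set Implicit Arguments.
Unset Strict Implicit.
Unset Printing Implicit Defensive.
Import Order.TTheory GRing.Theory Num.Theory.
Local Open Scope classical_set_scope.
Local Open Scope ring_scope.

(** On the plane [x + y + z = t] one has
    [x^3 + y^3 + z^3 - t^3 = 3 (x - t) (y - t) (z - t)], so with
    [n = t^3 + 3 N], [N != 0], the triples to be counted are the [(x, y, z)] on
    that plane with [(x - t) (y - t) (z - t) = N] ([cube_triplesP]).  Put
    [a = x - t], [b = y - t] and sort the triples by the product [d = a b], a
    nonzero divisor of [N].  Once [d] is fixed, [z - t = N / d] is known, hence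
    so is [a + b = - (N / d + 2 t)], and the triples with this [d] correspond to
    the ordered pairs of integers with prescribed sum [s] and product [d]
    ([cube_triples_fiber]).

    Such pairs are the orderings of the two roots of [X^2 - s X + d]
    ([sum_prod_pairs]).  There are two of them when [s^2 - 4 d] is a nonzero
    square, one when it vanishes, and none otherwise: [s] and any square root of
    [s^2 - 4 d] have the same parity, so a square discriminant always gives
    integer roots.  This is twice the square indicator, minus one when
    [s^2 = 4 d], and summing over [d] gives the formula; when [d != 0] and
    [s^2 = 4 d], the divisor [d] is automatically positive. *)

Lemma size_sum_fibers (T I : eqType) (s : seq T) (D : seq I) (f : T -> I) :
  uniq D -> {in s, forall x, f x \in D} ->
  size s = (\sum_(d <- D) count (fun x => f x == d) s)%N.
Proof.
move=> uD fD; under eq_bigr do rewrite -sum1_count.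
rewrite (exchange_big_dep predT) //= -sum1_size.
apply: eq_big_seq => x xs.
rewrite sum1_count (eq_count (a2 := pred1 (f x))) => [|d]; last first.
  by rewrite /= eq_sym.
by rewrite count_uniq_mem // fD.
Qed.

Lemma square_ind_eq1 (k : int) : square_ind (k ^+ 2) = 1.
Proof.
rewrite /square_ind ifT //; apply/asboolP; exists `|k|%N.
by rewrite abszE real_normK ?num_real.
Qed.

(** The integers [a], [b] with [a + b = s] and [a b = d] satisfy
    [(a - b)^2 = s^2 - 4 d]; conversely a square root of the discriminant has
    the parity of [s], so half its sum with [s] is an integer root. *)
Lemma sum_prod_pairs (s d : int) : exists l : seq (int * int),
  [/\ uniq l, forall a b, (a, b) \in l = (a + b == s) && (a * b == d)
    & (size l)%:Z = 2 * square_ind (s ^+ 2 - 4 * d) - (s ^+ 2 == 4 * d)%:Z].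
Proof.
have disc a b : a + b = s -> a * b = d -> s ^+ 2 - 4 * d = (a - b) ^+ 2.
  by move=> <- <-; ring.
have [[k dk]|nsq] := pselect (exists k : nat, s ^+ 2 - 4 * d = k%:Z ^+ 2);
  last first.
  exists [::]; split=> // [a b|].
    apply/esym/negP => /andP[/eqP ab /eqP ab']; apply: nsq; exists `|a - b|%N.
    by rewrite (disc a b) // abszE real_normK ?num_real.
  rewrite /square_ind ifF; last by apply/asboolP.
  case: eqP => // sd; case: nsq; exists 0%N; rewrite sd; ring.
have [c sc] : exists c : int, s = 2 * c + k%:Z.
  have : (2 %| (s - k%:Z) * (s - k%:Z))%Z.
    apply/dvdzP; exists (2 * d + k%:Z ^+ 2 - s * k%:Z).
    have -> : (s - k%:Z) * (s - k%:Z) = s ^+ 2 + k%:Z ^+ 2 - 2 * s * k%:Z by ring.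
    have -> : s ^+ 2 = k%:Z ^+ 2 + 4 * d by rewrite -dk; ring.
    ring.
  rewrite dvdzE abszM Euclid_dvdM // orbb => sk.
  have /dvdzP[c cE] : (2 %| s - k%:Z)%Z by rewrite dvdzE.
  by exists c; rewrite mulrC -cE subrK.
have dc : d = c * (c + k%:Z).
  suff : 4 * d = 4 * (c * (c + k%:Z)) by move/(mulfI (isT : (4 : int) != 0)).
  have -> : 4 * d = s ^+ 2 - k%:Z ^+ 2 by rewrite -dk; ring.
  rewrite sc; ring.
have roots a b : (a + b == s) && (a * b == d) =
    ((a, b) == (c, c + k%:Z)) || ((a, b) == (c + k%:Z, c)).
  rewrite !xpair_eqE; apply/idP/idP => [/andP[/eqP ab /eqP ab']|].
    have bE : b = s - a by rewrite -ab; ring.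
    have : (a - c) * (a - (c + k%:Z)) = 0.
      have -> : (a - c) * (a - (c + k%:Z))
        = a * (a - 2 * c - k%:Z) + c * (c + k%:Z) by ring.
      rewrite -dc -ab' bE sc; ring.
    move/eqP; rewrite mulf_eq0 !subr_eq0 => /orP[] /eqP aE.
    - by rewrite bE sc aE; apply/orP; left; rewrite eqxx; apply/eqP; ring.
    - by rewrite bE sc aE; apply/orP; right; rewrite eqxx; apply/eqP; ring.
  by case/orP=> /andP[/eqP-> /eqP->]; rewrite sc dc; apply/andP; split;
    apply/eqP; ring.
have -> : (s ^+ 2 == 4 * d) = (k == 0%N).
  by rewrite -subr_eq0 dk expf_eq0.
rewrite dk square_ind_eq1.
case: (eqVneq k 0%N) roots => [->|k0] roots.
  exists [:: (c, c)]; split=> // a b.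
  by rewrite roots addr0 orbb inE.
exists [:: (c, c + k%:Z); (c + k%:Z, c)]; split=> [|a b|] //=.
  rewrite inE xpair_eqE andbT negb_and; apply/orP; left.
  by apply: contra k0 => /eqP ck; apply/eqP; lia.
by rewrite roots !inE.
Qed.

Lemma cube_triplesP (t N x y z : int) :
  cube_triples t (t ^+ 3 + 3 * N) (x, y, z) <->
  (x - t) * (y - t) * (z - t) = N /\ x + y + z = t.
Proof.
have key : x + y + z = t -> x ^+ 3 + y ^+ 3 + z ^+ 3 =
    t ^+ 3 + 3 * ((x - t) * (y - t) * (z - t)) by move=> <-; ring.
rewrite /cube_triples /=; split=> -[H xyz]; split=> //; last by rewrite key // H.
apply: (mulfI (isT : (3 : int) != 0)); apply: (addrI (t ^+ 3)).
by rewrite -key.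
Qed.

Definition nz_divisors (N : int) : set int :=
  [set d : int | d != 0 /\ (d %| N)%Z].

Lemma finite_nz_divisors (N : int) : N != 0 -> finite_set (nz_divisors N).
Proof.
move=> N0; pose D := divisors `|N|%N.
apply: (@sub_finite_set _ _
  [set` map Posz D ++ map (fun k : nat => - k%:Z) D]); last exact: finite_seq.
move=> d [_ dN] /=.
have dD : `|d|%N \in D by rewrite -dvdn_divisors ?absz_gt0 // -dvdzE.
rewrite mem_cat; have [d0|d0] := leP 0 d; apply/orP; [left|right];
  by apply/mapP; exists `|d|%N => //; lia.
Qed.

Definition prod_class (t : int) (p : int * int * int) : int :=
  (p.1.1 - t) * (p.1.2 - t).

Lemma prod_class_nz_divisor (t N : int) (p : int * int * int) : N != 0 ->
  cube_triples t (t ^+ 3 + 3 * N) p -> nz_divisors N (prod_class t p).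
Proof.
case: p => [[x y] z] N0 /cube_triplesP[HN _]; rewrite /prod_class /=; split.
  by apply: contra N0 => /eqP d0; rewrite -HN d0 mul0r.
by rewrite -HN dvdz_mulr.
Qed.

(** All three factors of [N = (x - t) (y - t) (z - t)] are nonzero divisors of
    [N], and [z] is determined by [x] and [y]. *)
Lemma finite_cube_triples (t N : int) : N != 0 ->
  finite_set (cube_triples t (t ^+ 3 + 3 * N)).
Proof.
move=> N0; have fD := finite_nz_divisors N0.
apply: sub_finite_set (finite_image
  (fun q : int * int => (q.1 + t, q.2 + t, - q.1 - q.2 - t)) (finite_setX fD fD)).
move=> [[x y] z] /cube_triplesP[HN xyz]; exists (x - t, y - t) => /=.
  split; split => /=.
  - by apply: contra N0 => /eqP a0; rewrite -HN a0 !mul0r.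
  - by rewrite -HN -mulrA dvdz_mulr.
  - by apply: contra N0 => /eqP a0; rewrite -HN a0 mulr0 mul0r.
  - by rewrite -HN mulrAC dvdz_mull.
by rewrite !subrK; congr (_, _, _); rewrite -xyz; ring.
Qed.

(** Fixing [d = (x - t) (y - t)] fixes [z - t = N / d] and therefore the sum of
    [x - t] and [y - t]. *)
Lemma cube_triples_fiber (t N d x y z : int) : nz_divisors N d ->
  cube_triples t (t ^+ 3 + 3 * N) (x, y, z) /\ prod_class t (x, y, z) = d <->
  [/\ (x - t) + (y - t) = - ((N %/ d)%Z + 2 * t), (x - t) * (y - t) = d
    & z = t - x - y].
Proof.
move=> [d0 dN]; have NE := divzK dN; rewrite /prod_class /=.
split=> [[/cube_triplesP[HN xyz] dE]|[sE dE zE]].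
  have <- : z - t = (N %/ d)%Z by rewrite -HN dE mulKz.
  by split=> //; rewrite -xyz; ring.
split=> //; apply/cube_triplesP; rewrite dE zE; split; last by ring.
rewrite -[RHS]NE mulrC; congr (_ * _).
have -> : t - x - y - t = - (x - t + (y - t)) - 2 * t by ring.
by rewrite sE; ring.
Qed.

Lemma count_cube_triples_fiber (t N d : int) (N0 : N != 0) : nz_divisors N d ->
  (count (fun p => prod_class t p == d)
     (fset_set (cube_triples t (t ^+ 3 + 3 * N))))%:Z =
  2 * square_ind (((N %/ d)%Z + 2 * t) ^+ 2 - 4 * d)
  - (((N %/ d)%Z + 2 * t) ^+ 2 == 4 * d)%:Z.
Proof.
move=> Dd; have [l [ul memE]] := sum_prod_pairs (- ((N %/ d)%Z + 2 * t)) d.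
rewrite sqrrN => <-; congr Posz.
pose h (q : int * int) := (q.1 + t, q.2 + t, - t - q.1 - q.2).
have hI : injective h.
  by move=> [a b] [a' b'] [] /addIr -> /addIr ->.
rewrite -(size_map h) -size_filter; apply/perm_size/uniq_perm.
- exact/filter_uniq/fset_uniq.
- by rewrite map_inj_uniq.
move=> [[x y] z].
rewrite mem_filter in_fset_set; last exact: finite_cube_triples.
have -> : ((x, y, z) \in map h l) =
    ((x - t, y - t) \in l) && (z == t - x - y).
  apply/mapP/andP => [[[a b] abl [-> -> ->]]|[xyl /eqP->]].
    by rewrite !addrK abl; split=> //; apply/eqP => /=; ring.
  by exists (x - t, y - t) => //; rewrite /h /= !subrK; congr (_, _, _); ring.
rewrite memE; apply/andP/andP => [[/eqP dE /set_mem xyz]|[/andP[/eqP ? /eqP ?] /eqP ?]].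
  by have [-> -> ->] := (cube_triples_fiber t x y z Dd).1 (conj xyz dE);
    rewrite !eqxx.
have [//|xyz ->] := (cube_triples_fiber t x y z Dd).2.
by rewrite eqxx; split=> //; apply/mem_set.
Qed.

Theorem theorem4 (n t : int) (hne : n <> t ^+ 3)
    (hmod : (n = t ^+ 3 %[mod 3])%Z) :
  let N1 := ((n - t ^+ 3) %/ 3)%Z in
  finite_set (cube_triples t n) /\
  (num_cube_triples t n)%:Z =
    - (\sum_(d \in [set d : int | [/\ 0 < d, (d %| N1)%Z
                      & ((N1 %/ d)%Z + 2 * t) ^+ 2 = 4 * d]]) (1 : int))
    + 2 * (\sum_(d \in [set d : int | d != 0 /\ (d %| N1)%Z])
             square_ind (((N1 %/ d)%Z + 2 * t) ^+ 2 - 4 * d)).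
Proof.
move=> N1.
have nE : n = t ^+ 3 + 3 * N1.
  have dvd3 : (3 %| n - t ^+ 3)%Z by rewrite -eqz_mod_dvd; apply/eqP.
  by rewrite [3 * _]mulrC /N1 (divzK dvd3) addrC subrK.
have N0 : N1 != 0 by apply/eqP => N0; apply: hne; rewrite nE N0 mulr0 addr0.
move: (N1) nE N0 => N -> N0.
have fA := finite_cube_triples t N0; have fD := finite_nz_divisors N0.
split=> //; rewrite /num_cube_triples -/(nz_divisors N).
rewrite (@size_sum_fibers _ _ _ (fset_set (nz_divisors N)) (prod_class t));
  first last.
- move=> p; rewrite in_fset_set // => /set_mem Ap.
  by rewrite in_fset_set //; apply/mem_set/prod_class_nz_divisor.
- exact: fset_uniq.
have -> : [set d : int | [/\ 0 < d, (d %| N)%Z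
            & ((N %/ d)%Z + 2 * t) ^+ 2 = 4 * d]] =
    nz_divisors N `&` [set d : int | ((N %/ d)%Z + 2 * t) ^+ 2 = 4 * d].
  apply/seteqP; split=> d /= => [[d0 dN sd]|[[d0 dN] sd]].
    by rewrite /nz_divisors /= gt_eqF.
  (* here [4 d] is a square, and [d] is nonzero *)
  have := sqr_ge0 ((N %/ d)%Z + 2 * t); rewrite sd => d4.
  by split=> //; lia.
rewrite fsbig_mkcondr !fsbig_finite // -natz natr_sum mulr_sumr -sumrN -big_split.
apply: eq_big_seq => d; rewrite in_fset_set // => /set_mem Dd.
rewrite natz count_cube_triples_fiber //= [RHS]addrC; congr (_ - _).
case: eqP => sd; first by rewrite ifT //; apply/mem_set.
by rewrite ifF //; apply/negP => /set_mem.
Qed.
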